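(* Let $k$ be an infinite field of characteristic $\neq 2$ and $n\geq 1$ an integer. Let $a\in k^{\times}$, $\underline{c}=(c_1,\ldots,c_n)\in k^n$, and let $\underline{d}=(d_{i,j})_{i,j=1,\ldots,n}$ be a symmetric matrix with entries in $k$. Put $E=X_1^{1}$, $X=X_1^{x}$, $Y_i=X_1^{y_i}$ in $T$. Then the degree $4$ polynomials $$(XY_i+Y_iX)^2 - 4X^2Y_i^2 + 4c_i\,E^2X^2 \qquad (1\leq i\leq n)$$ and $$2(Y_iY_j+Y_jY_i)X^2 - (XY_i+Y_iX)(XY_j+Y_jX) - 2d_{i,j}\,E^2X^2 \qquad (1\leq i\leq j\leq n)$$ are polynomial $E(n)$-identities for the Galois object $A(a,\underline{c},\underline{d})$ over $E(n)$.
   Context: All algebras are associative and unital, and all tensor products are over $k$; $k^\times=k\setminus\{0\}$. For a Hopf algebra $H$ over $k$ with coproduct $\Delta$, write $\Delta(h) = h_1\otimes h_2$ (implicit sum). A (right) $H$-comodule algebra is an algebra $A$ with a right $H$-comodule structure whose coaction $\delta : A\to A\otimes H$ is an algebra map; $H$-comodule algebra maps are algebra maps that are $H$-colinear. A Galois object over $H$ is an $H$-comodule algebra $A$ whose subalgebra of coinvariants $A^H=\{a\in A \mid \delta(a)=a\otimes 1\}$ equals $k\,1_A$ and for which the map $\beta : A\otimes A\to A\otimes H$, $a\otimes a'\mapsto (a\otimes 1)\,\delta(a')$, is a linear isomorphism. Polynomial identities: for each $i=1,2,\ldots$ let $X_i^H$ be a copy of the vector space $H$, whose element corresponding to $h\in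 H$ is denoted $X_i^h$ (linear in $h$). Let $T=T\bigl(\bigoplus_{i\geq 1}X_i^H\bigr)$ be the tensor algebra, graded with all $X_i^h$ of degree $1$; it is an $H$-comodule algebra with coaction $\delta(X_i^h)=X_i^{h_1}\otimes h_2$. An element $P\in T$ is a polynomial $H$-identity for an $H$-comodule algebra $A$ if $\mu(P)=0$ for all $H$-comodule algebra maps $\mu : T\to A$. Here $T$ is formed with $H=E(n)$. The Hopf algebra $E(n)$: generated as an algebra by $x,y_1,\ldots,y_n$ with relations $x^2=1$, $y_i^2=0$, $y_ix+xy_i=0$, $y_iy_j+y_jy_i=0$ for all $i,j=1,\ldots,n$; it has dimension $2^{n+1}$. Its coproduct, counit and antipode are given by $\Delta(x)=x\otimes x$, $\Delta(y_i)=1\otimes y_i+y_i\otimes x$, $\varepsilon(x)=1$, $\varepsilon(y_i)=0$, $S(x)=x$, $S(y_i)=-y_ix$ for all $i=1,\ldots,n$. The comodule algebra $A(a,\underline{c},\underline{d})$: generated as an algebra by symbols $u,u_1,\ldots,u_n$ with relations $u^2=a$, $u_i^2=c_i$, $uu_i+u_iu=0$, $u_iu_j+u_ju_i=d_{i,j}$ for all $i,j=1,\ldots,n$, with coaction $\delta(u)=u\otimes x$, $\delta(u_i)=1\otimes y_i+u_i\otimes x$ for all $i=1,\ldots,n$. *)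

(* Defs.v *)
From HB Require Import structures.
From mathcomp Require Import all_boot all_algebra.
From mathcomp Require Import generic_quotient.
From mathcomp Require Import boolp classical_sets cardinality.

Set Implicit Arguments.
Unset Strict Implicit.
Unset Printing Implicit Defensive.

Import GRing.Theory.
Local Open Scope ring_scope.
Local Open Scope quotient_scope.

Reserved Notation "c %:S" (at level 2, left associativity, format "c %:S").
Reserved Notation "a \ox b" (at level 38, left associativity).
Reserved Notation "{ 'algmap' A -> B }"
  (at level 0, A at level 98, B at level 99, format "{ 'algmap'  A  ->  B }").

(* A k-algebra is a ring A with a ring morphism k -> A, c |-> c%:S, whose     *)
(* image is central; the scalar multiple of a by c is c%:S * a. The library   *)
(* structure GRing.Algebra is not used because it forces 1 != 0: the          *)
(* relations of A(a, c, d) make it the zero algebra when some d i i differs   *)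
(* from 2 c i.                                                                *)
HB.mixin Record PzRing_isPzAlgebra (k : fieldType) A of GRing.PzRing A := {
  scal : k -> A;
  scal_is_zmod_morphism : zmod_morphism scal;
  scal_is_monoid_morphism : monoid_morphism scal;
  scalC : forall (c : k) (a : A), scal c * a = a * scal c
}.
#[short(type="pzAlgType")]
HB.structure Definition PzAlgebra (k : fieldType) :=
  {A of PzRing_isPzAlgebra k A & GRing.PzRing A}.

Notation "c %:S" := (scal c) : ring_scope.

HB.instance Definition _ (k : fieldType) (A : pzAlgType k) :=
  GRing.isZmodMorphism.Build k A (@scal k A) scal_is_zmod_morphism.
HB.instance Definition _ (k : fieldType) (A : pzAlgType k) :=
  GRing.isMonoidMorphism.Build k A (@scal k A) scal_is_monoid_morphism.

HB.mixin Record isScalMorphism (k : fieldType) (A B : pzAlgType k)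
    (f : A -> B) := {
  rmorph_scal : forall c : k, f c%:S = c%:S
}.
#[short(type="algMap")]
HB.structure Definition AlgMorphism (k : fieldType) (A B : pzAlgType k) :=
  {f of @GRing.RMorphism A B f & isScalMorphism k A B f}.

Notation "{ 'algmap' A -> B }" := (@algMap _ A%type B%type) : type_scope.

Definition k_linear (k : fieldType) (A B : pzAlgType k) (f : A -> B) : Prop :=
  forall (c : k) (x y : A), f (c%:S * x + y) = c%:S * f x + f y.

Section KLinear.
Variables (k : fieldType) (A B : pzAlgType k) (f : A -> B).
Hypothesis fL : k_linear f.

Lemma klinD x y : f (x + y) = f x + f y.
Proof. by have := fL 1 x y; rewrite !rmorph1 !mul1r. Qed.

Lemma klin0 : f 0 = 0.
Proof. by apply: (addrI (f 0)); rewrite -klinD !addr0. Qed.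

Lemma klinZ c x : f (c%:S * x) = c%:S * f x.
Proof. by have := fL c x 0; rewrite klin0 !addr0. Qed.

End KLinear.

Lemma algmap_klin (k : fieldType) (A B : pzAlgType k) (f : {algmap A -> B}) :
  k_linear f.
Proof. by move=> c x y; rewrite rmorphD rmorphM /= rmorph_scal. Qed.

Lemma comp_klin (k : fieldType) (A B C : pzAlgType k) (f : B -> C)
  (g : A -> B) : k_linear f -> k_linear g -> k_linear (f \o g).
Proof. by move=> fL gL c x y; rewrite /= gL fL. Qed.

Lemma id_klin (k : fieldType) (A : pzAlgType k) : k_linear (@idfun A).
Proof. by []. Qed.

HB.instance Definition _ (k : fieldType) (A : pzAlgType k) :=
  isScalMorphism.Build k A A idfun (fun=> erefl).

Section CompAlgmap.
Variables (k : fieldType) (A B C : pzAlgType k).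
Variables (f : {algmap B -> C}) (g : {algmap A -> B}).
Fact comp_scal_morphism (c : k) : (f \o g) c%:S = c%:S.
Proof. by rewrite /= !rmorph_scal. Qed.
HB.instance Definition _ :=
  isScalMorphism.Build k A C (f \o g) comp_scal_morphism.
End CompAlgmap.

Section RegularAlg.
Variable k : fieldType.
Fact reg_scal_zmod : zmod_morphism (fun c : k => (c : k^o)).
Proof. by []. Qed.
Fact reg_scal_monoid : monoid_morphism (fun c : k => (c : k^o)).
Proof. by []. Qed.
Fact reg_scalC (c : k) (a : k^o) : (c : k^o) * a = a * (c : k^o).
Proof. exact: mulrC. Qed.
HB.instance Definition _ :=
  PzRing_isPzAlgebra.Build k k^o reg_scal_zmod reg_scal_monoid reg_scalC.
End RegularAlg.

Section ConverseAlg.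
Variables (k : fieldType) (A : pzAlgType k).
Local Notation Ac := (GRing.converse A).
Fact conv_scal_zmod : zmod_morphism (fun c : k => (c%:S : A) : Ac).
Proof. by move=> c d; rewrite rmorphB. Qed.
Fact conv_scal_monoid : monoid_morphism (fun c : k => (c%:S : A) : Ac).
Proof.
have [h1 hM] := @scal_is_monoid_morphism k A.
by split=> [|c d]; [exact: h1 | rewrite mulrC; exact: hM].
Qed.
Fact conv_scalC (c : k) (a : Ac) :
  ((c%:S : A) : Ac) * a = a * ((c%:S : A) : Ac).
Proof. by symmetry; exact: (@scalC k A). Qed.
HB.instance Definition _ :=
  PzRing_isPzAlgebra.Build k Ac conv_scal_zmod conv_scal_monoid conv_scalC.
End ConverseAlg.

Section IsAlgmap.
Variable k : fieldType.

Definition is_algmap (A B : pzAlgType k) (f : A -> B) : Prop :=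
  [/\ zmod_morphism f, monoid_morphism f & forall c : k, f c%:S = c%:S].

Lemma algmapP (A B : pzAlgType k) (f : {algmap A -> B}) : is_algmap f.
Proof.
split; [exact: raddfB | split; [exact: rmorph1 | exact: rmorphM] |].
exact: rmorph_scal.
Qed.

Lemma comp_is_algmap (A B C : pzAlgType k) (f : B -> C) (g : A -> B) :
  is_algmap f -> is_algmap g -> is_algmap (f \o g).
Proof.
move=> [fB [f1 fM] fc] [gB [g1 gM] gc]; split=> [x y||c] /=.
- by rewrite gB fB.
- by split=> [|x y] /=; rewrite ?g1 ?f1 // gM fM.
- by rewrite gc fc.
Qed.

Lemma scal_is_algmap (A B : pzAlgType k) (e : {algmap A -> k^o}) :
  is_algmap (fun a => (e a : k)%:S : B).
Proof.
split=> [x y||c].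
- by rewrite rmorphB (rmorphB (@scal k B)).
- split=> [|x y]; first by rewrite rmorph1; exact: (rmorph1 (@scal k B)).
  by rewrite rmorphM; exact: (rmorphM (@scal k B)).
- by rewrite rmorph_scal.
Qed.

Variables (A B : pzAlgType k) (f : A -> B).
Hypothesis fA : is_algmap f.

Lemma is_algmapD : {morph f : x y / x + y}.
Proof.
have [fB _ _] := fA; have f0 : f 0 = 0 by rewrite -(subrr 0) fB subrr.
have fN x : f (- x) = - f x by rewrite -(sub0r x) fB f0 sub0r.
by move=> x y; rewrite -{1}(opprK y) fB fN opprK.
Qed.
Lemma is_algmapM : {morph f : x y / x * y}.
Proof. by have [_ [_ fM] _] := fA. Qed.
Lemma is_algmap1 : f 1 = 1.
Proof. by have [_ [f1 _] _] := fA. Qed.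
Lemma is_algmap_scal c : f c%:S = c%:S.
Proof. by have [_ _ fc] := fA. Qed.
Lemma is_algmap_klin : k_linear f.
Proof. by move=> c x y; rewrite is_algmapD is_algmapM is_algmap_scal. Qed.

End IsAlgmap.

(* A (x) B is the set of formal sums of pairs modulo the congruence generated *)
(* by biadditivity and k-balancedness.                                        *)
Section Tensor.
Variables (k : fieldType) (A B : pzAlgType k).

Inductive tcong : seq (A * B) -> seq (A * B) -> Prop :=
| tc_refl s : tcong s s
| tc_sym s t : tcong s t -> tcong t s
| tc_trans s t u : tcong s t -> tcong t u -> tcong s u
| tc_cat s s' t t' : tcong s s' -> tcong t t' -> tcong (s ++ t) (s' ++ t')
| tc_catC s t : tcong (s ++ t) (t ++ s)
| tc_zero b : tcong [:: (0, b)] [::]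
| tc_addl a a' b : tcong [:: (a + a', b)] [:: (a, b); (a', b)]
| tc_addr a b b' : tcong [:: (a, b + b')] [:: (a, b); (a, b')]
| tc_scal (c : k) a b : tcong [:: (c%:S * a, b)] [:: (a, c%:S * b)].

Let trel (s t : seq (A * B)) : bool := `[< tcong s t >].

Fact trel_refl : reflexive trel.
Proof. by move=> s; apply/asboolP; constructor. Qed.
Fact trel_sym : symmetric trel.
Proof. by move=> s t; apply/asboolP/asboolP; exact: tc_sym. Qed.
Fact trel_trans : transitive trel.
Proof. by move=> t s u /asboolP st /asboolP tu; apply/asboolP/(tc_trans st). Qed.

Definition tequiv := EquivRel trel trel_refl trel_sym trel_trans.

Definition tensor : Type := {eq_quot tequiv}.
HB.instance Definition _ := Choice.on tensor.
HB.instance Definition _ := EqQuotient.on tensor.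

Definition tsum (s : seq (A * B)) : tensor := \pi_tensor s.

Lemma tsumP s t : tsum s = tsum t <-> tcong s t.
Proof. by split=> [/eqmodP/asboolP //|h]; apply/eqmodP/asboolP. Qed.

Lemma tsumW (P : tensor -> Prop) : (forall s, P (tsum s)) -> forall t, P t.
Proof. by move=> Ps t; rewrite -[t]reprK; exact: Ps. Qed.

Lemma tsum_repr t : tsum (repr t) = t. Proof. exact: reprK. Qed.

Lemma repr_tsum s : tcong (repr (tsum s)) s.
Proof. by apply/tsumP; rewrite tsum_repr. Qed.

Definition tadd (t u : tensor) : tensor := tsum (repr t ++ repr u).
Definition topp (t : tensor) : tensor :=
  tsum [seq (- p.1, p.2) | p <- repr t].

Lemma taddE s t : tadd (tsum s) (tsum t) = tsum (s ++ t).
Proof. by apply/tsumP/tc_cat; exact: repr_tsum. Qed.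

Lemma toppE t : tadd (topp t) t = tsum [::].
Proof.
rewrite -{2}[t]tsum_repr /topp; elim: (repr t) => [|p s IHs] /=.
  exact: taddE.
rewrite taddE cat_cons -cat1s.
apply/tsumP.
have h1 : tcong ([seq (- p0.1, p0.2) | p0 <- s] ++ p :: s)
  (p :: s ++ [seq (- p0.1, p0.2) | p0 <- s]) by exact: tc_catC.
apply: (tc_trans (tc_cat (tc_refl _) h1)).
rewrite cat_cons -(cat1s p) catA.
have h2 : tcong ([:: (- p.1, p.2)] ++ [:: p]) [::].
  apply: (tc_trans (tc_sym _) (tc_zero p.2)).
  by have := tc_addl (- p.1) p.1 p.2; rewrite addNr; case: p {h1}.
apply: (tc_trans (tc_cat h2 (tc_catC _ _))) => /=.
by apply/tsumP; rewrite -taddE.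
Qed.

Fact taddA : associative tadd.
Proof.
by elim/tsumW=> s; elim/tsumW=> t; elim/tsumW=> u; rewrite !taddE catA.
Qed.
Fact taddC : commutative tadd.
Proof.
by elim/tsumW=> s; elim/tsumW=> t; rewrite !taddE; apply/tsumP/tc_catC.
Qed.
Fact tadd0 : left_id (tsum [::]) tadd.
Proof. by elim/tsumW=> s; rewrite !taddE. Qed.

HB.instance Definition _ :=
  GRing.isZmodule.Build tensor taddA taddC tadd0 toppE.

Definition pure (a : A) (b : B) : tensor := tsum [:: (a, b)].
Local Notation "a \ox b" := (pure a b).

Lemma tsumD s t : tsum (s ++ t) = tsum s + tsum t.
Proof. by rewrite -taddE. Qed.

Lemma tsumE s : tsum s = \sum_(p <- s) p.1 \ox p.2.
Proof.
elim: s => [|[a b] s IHs]; first by rewrite big_nil.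
by rewrite big_cons -IHs -tsumD.
Qed.

Lemma pureDl a a' b : (a + a') \ox b = a \ox b + a' \ox b.
Proof. by rewrite -tsumD; apply/tsumP/tc_addl. Qed.
Lemma pureDr a b b' : a \ox (b + b') = a \ox b + a \ox b'.
Proof. by rewrite -tsumD; apply/tsumP/tc_addr. Qed.
Lemma pureZ (c : k) a b : (c%:S * a) \ox b = a \ox (c%:S * b).
Proof. by apply/tsumP/tc_scal. Qed.
Lemma pure0l b : 0 \ox b = 0. Proof. by apply/tsumP/tc_zero. Qed.
Lemma pure0r a : a \ox 0 = 0.
Proof. by apply: (addrI (a \ox 0)); rewrite -pureDr !addr0. Qed.
Lemma pureNl a b : (- a) \ox b = - (a \ox b).
Proof. by apply: (addrI (a \ox b)); rewrite -pureDl !subrr pure0l. Qed.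
Lemma pureNr a b : a \ox (- b) = - (a \ox b).
Proof. by apply: (addrI (a \ox b)); rewrite -pureDr !subrr pure0r. Qed.

Lemma tensor_ind (P : tensor -> Prop) :
  P 0 -> (forall a b, P (a \ox b)) -> (forall t u, P t -> P u -> P (t + u)) ->
  forall t, P t.
Proof.
move=> P0 Pp PD; elim/tsumW=> s; rewrite tsumE.
by elim: s => [|p s IHs]; rewrite ?big_nil ?big_cons //; apply: PD.
Qed.

Definition balanced (V : zmodType) (f : A -> B -> V) : Prop :=
  [/\ forall b, {morph f^~ b : a a' / a + a'},
      forall a, {morph f a : b b' / b + b'}
    & forall (c : k) a b, f (c%:S * a) b = f a (c%:S * b)].

Definition tlift (V : zmodType) (f : A -> B -> V) (t : tensor) : V :=
  \sum_(p <- repr t) f p.1 p.2.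

Section Lift.
Variables (V : zmodType) (f : A -> B -> V).
Hypothesis fB : balanced f.

Lemma tlift_tsum s : tlift f (tsum s) = \sum_(p <- s) f p.1 p.2.
Proof.
have [fDl fDr fZ] := fB; suff inv u v : tcong u v ->
    \sum_(p <- u) f p.1 p.2 = \sum_(p <- v) f p.1 p.2 by exact/inv/repr_tsum.
elim=> {s u v} //=.
- by move=> s t u _ -> _ ->.
- by move=> s s' t t' _ IHs _ IHt; rewrite !big_cat /= IHs IHt.
- by move=> s t; rewrite !big_cat /= addrC.
- move=> b; rewrite big_seq1 big_nil /=.
  by apply: (addrI (f 0 b)); rewrite -fDl !addr0.
- by move=> a a' b; rewrite !big_cons !big_nil /= !addr0 fDl.
- by move=> a b b'; rewrite !big_cons !big_nil /= !addr0 fDr.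
- by move=> c a b; rewrite !big_seq1 /= fZ.
Qed.

Lemma tlift_pure a b : tlift f (a \ox b) = f a b.
Proof. by rewrite tlift_tsum big_seq1. Qed.

Lemma tliftD : {morph tlift f : t u / t + u}.
Proof.
by elim/tsumW=> s; elim/tsumW=> t; rewrite -tsumD !tlift_tsum big_cat.
Qed.

Lemma tlift0 : tlift f 0 = 0.
Proof. by apply: (addrI (tlift f 0)); rewrite -tliftD !addr0. Qed.

End Lift.

(* (a (x) b) (a' (x) b') = a a' (x) b b' *)
Definition tmul (t u : tensor) : tensor :=
  tlift (fun a b => tlift (fun a' b' => (a * a') \ox (b * b')) u) t.

Fact tmul_balanced2 a b : balanced (fun a' b' => (a * a') \ox (b * b')).
Proof.
split=> [b' x y|a' x y|c a' b'] /=; rewrite ?mulrDr ?pureDl ?pureDr //.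
by rewrite !mulrA -!scalC -!mulrA pureZ.
Qed.

Fact tmul_balanced1 u :
  balanced (fun a b => tlift (fun a' b' => (a * a') \ox (b * b')) u).
Proof.
have B2 := tmul_balanced2.
split=> [b x y|a x y|c a b] /=; elim/tensor_ind: u => [|a' b'|t u IHt IHu];
  rewrite ?(tlift_pure (B2 _ _)) ?(tlift0 (B2 _ _)) ?addr0 //.
- by rewrite mulrDl pureDl.
- by rewrite !(tliftD (B2 _ _)) IHt IHu addrACA.
- by rewrite mulrDl pureDr.
- by rewrite !(tliftD (B2 _ _)) IHt IHu addrACA.
- by rewrite -!mulrA pureZ.
- by rewrite !(tliftD (B2 _ _)) IHt IHu.
Qed.

Lemma tmul_pure a b a' b' :
  tmul (a \ox b) (a' \ox b') = (a * a') \ox (b * b').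
Proof.
by rewrite /tmul (tlift_pure (tmul_balanced1 _)) (tlift_pure (tmul_balanced2 _ _)).
Qed.

Fact tmulDl : left_distributive tmul +%R.
Proof. by move=> t u v; rewrite /tmul (tliftD (tmul_balanced1 _)). Qed.

Fact tmul0l u : tmul 0 u = 0.
Proof. by apply: (addrI (tmul 0 u)); rewrite -tmulDl !addr0. Qed.

Fact tmulDr : right_distributive tmul +%R.
Proof.
elim/tensor_ind=> [|a b|s t IHs IHt] u v; rewrite ?tmul0l ?addr0 //.
  rewrite /tmul !(tlift_pure (tmul_balanced1 _)).
  exact: (tliftD (tmul_balanced2 _ _)).
by rewrite !tmulDl IHs IHt addrACA.
Qed.

Fact tmul0r u : tmul u 0 = 0.
Proof. by apply: (addrI (tmul u 0)); rewrite -tmulDr !addr0. Qed.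

Fact tmulA : associative tmul.
Proof.
elim/tensor_ind=> [|a b|s s' IHs IHs'] t u; rewrite ?tmul0l //; last first.
  by rewrite !tmulDl IHs IHs'.
elim/tensor_ind: t => [|a' b'|t t' IHt IHt']; rewrite ?(tmul0l, tmul0r) //.
  elim/tensor_ind: u => [|x y|u u' IHu IHu']; rewrite ?tmul0r //.
    by rewrite !tmul_pure !mulrA.
  by rewrite !tmulDr IHu IHu'.
by rewrite tmulDl !tmulDr tmulDl IHt IHt'.
Qed.

Fact tmul1l : left_id (1 \ox 1) tmul.
Proof.
elim/tensor_ind=> [|a b|s s' IHs IHs']; rewrite ?tmul0r //.
  by rewrite tmul_pure !mul1r.
by rewrite tmulDr IHs IHs'.
Qed.

Fact tmul1r : right_id (1 \ox 1) tmul.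
Proof.
elim/tensor_ind=> [|a b|s s' IHs IHs']; rewrite ?tmul0l //.
  by rewrite tmul_pure !mulr1.
by rewrite tmulDl IHs IHs'.
Qed.

HB.instance Definition _ :=
  GRing.Zmodule_isPzRing.Build tensor tmulA tmul1l tmul1r tmulDl tmulDr.

Lemma pureM a b a' b' : (a \ox b) * (a' \ox b') = (a * a') \ox (b * b').
Proof. exact: tmul_pure. Qed.

Lemma pure11 : 1 \ox 1 = 1. Proof. by []. Qed.

Definition tscal (c : k) : tensor := (c%:S : A) \ox 1.

Fact tscal_zmod : zmod_morphism tscal.
Proof. by move=> c d; rewrite /tscal rmorphB pureDl pureNl. Qed.
Fact tscal_monoid : monoid_morphism tscal.
Proof. by split=> [|c d]; rewrite /tscal ?rmorph1 // pureM rmorphM mulr1. Qed.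
Fact tscalC (c : k) (t : tensor) : tscal c * t = t * tscal c.
Proof.
elim/tensor_ind: t => [|a b|s t IHs IHt]; rewrite ?mulr0 ?mul0r //.
  by rewrite !pureM mulr1 mul1r scalC.
by rewrite mulrDl mulrDr IHs IHt.
Qed.

HB.instance Definition _ :=
  PzRing_isPzAlgebra.Build k tensor tscal_zmod tscal_monoid tscalC.

Lemma tscalE (c : k) : c%:S = (c%:S : A) \ox 1. Proof. by []. Qed.

Lemma pureZl (c : k) a b : (c%:S * a) \ox b = c%:S * (a \ox b).
Proof. by rewrite tscalE pureM mul1r. Qed.
Lemma pureZr (c : k) a b : a \ox (c%:S * b) = c%:S * (a \ox b).
Proof. by rewrite -pureZ pureZl. Qed.

End Tensor.

Notation "a \ox b" := (pure a b) : ring_scope.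

Section TliftTheory.
Variables (k : fieldType) (A B : pzAlgType k).

Lemma tlift_monoid (C : pzRingType) (f : A -> B -> C) : balanced f ->
  f 1 1 = 1 -> (forall a b a' b', f (a * a') (b * b') = f a b * f a' b') ->
  monoid_morphism (tlift f).
Proof.
move=> fB f1 fM; split=> [|s t]; first by rewrite -pure11 tlift_pure.
elim/tensor_ind: s => [|a b|s s' IHs IHs']; rewrite ?mul0r ?tlift0 ?mul0r //.
  elim/tensor_ind: t => [|a' b'|t t' IHt IHt'];
    rewrite ?mulr0 ?tlift0 ?mulr0 //; first by rewrite pureM !tlift_pure.
  by rewrite mulrDr !tliftD // IHt IHt' mulrDr.
by rewrite mulrDl !tliftD // IHs IHs' mulrDl.
Qed.

Lemma tlift_zmod (V : zmodType) (f : A -> B -> V) :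
  balanced f -> zmod_morphism (tlift f).
Proof.
move=> fB x y; apply: (addIr (tlift f y)).
by rewrite -tliftD // !subrK.
Qed.

Lemma tlift_scal (C : pzAlgType k) (f : A -> B -> C) : balanced f ->
  (forall c, f c%:S 1 = c%:S) -> forall c, tlift f c%:S = c%:S.
Proof. by move=> fB fc c; rewrite tscalE tlift_pure. Qed.

Lemma mul_balanced (C : pzAlgType k) (f : A -> C) (g : B -> C) :
  k_linear f -> k_linear g -> balanced (fun a b => f a * g b).
Proof.
move=> fL gL; split=> [b x y|a x y|c a b] /=.
- by rewrite (klinD fL) mulrDl.
- by rewrite (klinD gL) mulrDr.
- by rewrite (klinZ fL) (klinZ gL) !mulrA scalC.
Qed.

Lemma mul_is_algmap (C : pzAlgType k) (f : A -> C) (g : B -> C) :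
  is_algmap f -> is_algmap g -> (forall a b, f a * g b = g b * f a) ->
  is_algmap (tlift (fun a b => f a * g b)).
Proof.
move=> fA gA fgC.
have fgB := mul_balanced (is_algmap_klin fA) (is_algmap_klin gA).
split; first exact: tlift_zmod.
  apply: tlift_monoid => // [|a b a' b'].
    by rewrite (is_algmap1 fA) (is_algmap1 gA) mulr1.
  rewrite (is_algmapM fA) (is_algmapM gA) -!mulrA; congr (_ * _).
  by rewrite !mulrA fgC.
by apply: tlift_scal => // c; rewrite (is_algmap_scal fA) (is_algmap1 gA) mulr1.
Qed.

End TliftTheory.

Section Tmap.
Variables (k : fieldType) (A A' B B' : pzAlgType k).

Definition tmap (f : A -> A') (g : B -> B') : tensor A B -> tensor A' B' :=
  tlift (fun a b => f a \ox g b).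

Lemma tmap_balanced (f : A -> A') (g : B -> B') :
  k_linear f -> k_linear g -> balanced (fun a b => f a \ox g b).
Proof.
move=> fL gL; split=> [b x y|a x y|c a b] /=.
- by rewrite (klinD fL) pureDl.
- by rewrite (klinD gL) pureDr.
- by rewrite (klinZ fL) (klinZ gL) pureZ.
Qed.

Lemma tmap_pure (f : A -> A') (g : B -> B') a b :
  k_linear f -> k_linear g -> tmap f g (a \ox b) = f a \ox g b.
Proof. by move=> fL gL; rewrite /tmap (tlift_pure (tmap_balanced fL gL)). Qed.

Lemma tmapD (f : A -> A') (g : B -> B') :
  k_linear f -> k_linear g -> {morph tmap f g : s t / s + t}.
Proof. by move=> fL gL; apply: tliftD; apply: tmap_balanced. Qed.

Lemma tmap0 (f : A -> A') (g : B -> B') : k_linear f -> k_linear g -> tmap f g 0 = 0.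
Proof. by move=> fL gL; apply: tlift0; apply: tmap_balanced. Qed.

Lemma tmap_klin (f : A -> A') (g : B -> B') : k_linear f -> k_linear g -> k_linear (tmap f g).
Proof.
move=> fL gL c s t; rewrite tmapD //; congr (_ + _).
elim/tensor_ind: s => [|a b|s s' IHs IHs']; rewrite ?mulr0 ?tmap0 ?mulr0 //.
  by rewrite -pureZl !tmap_pure // (klinZ fL) pureZl.
by rewrite mulrDr !tmapD // IHs IHs' mulrDr.
Qed.

Section TmapAlg.
Variables (f : {algmap A -> A'}) (g : {algmap B -> B'}).
Let fgB := tmap_balanced (algmap_klin f) (algmap_klin g).
Fact tmap_zmod : zmod_morphism (tmap f g). Proof. exact: tlift_zmod. Qed.
Fact tmap_monoid : monoid_morphism (tmap f g).
Proof.
apply: tlift_monoid => //; first by rewrite !rmorph1.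
by move=> a b a' b'; rewrite !rmorphM pureM.
Qed.
Fact tmap_scal (c : k) : tmap f g c%:S = c%:S.
Proof. by apply: tlift_scal => // {}c; rewrite rmorph_scal rmorph1. Qed.
HB.instance Definition _ := GRing.isZmodMorphism.Build _ _ (tmap f g) tmap_zmod.
HB.instance Definition _ :=
  GRing.isMonoidMorphism.Build _ _ (tmap f g) tmap_monoid.
HB.instance Definition _ :=
  isScalMorphism.Build k (tensor A B) (tensor A' B') (tmap f g) tmap_scal.
End TmapAlg.

End Tmap.

Section Tassoc.
Variables (k : fieldType) (A B C : pzAlgType k).

Definition tassoc : tensor (tensor A B) C -> tensor A (tensor B C) :=
  tlift (fun ab c => tlift (fun a b => a \ox (b \ox c)) ab).

Fact tassoc_balanced2 c :
  balanced (fun (a : A) (b : B) => a \ox (b \ox (c : C))).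
Proof.
split=> [b x y|a x y|d a b] /=; rewrite ?pureDl ?pureDr //.
by rewrite pureZ pureZl.
Qed.

Fact tassoc_balanced1 :
  balanced (fun ab (c : C) => tlift (fun (a : A) (b : B) => a \ox (b \ox c)) ab).
Proof.
have B2 := tassoc_balanced2.
split=> [c s t|t x y|d t c] /=; first exact: (tliftD (B2 c)).
  elim/tensor_ind: t => [|a b|s t IHs IHt];
    rewrite ?(tlift0 (B2 _)) ?(tlift_pure (B2 _)) ?addr0 ?pureDr //.
  by rewrite !(tliftD (B2 _)) IHs IHt addrACA.
elim/tensor_ind: t => [|a b|s t IHs IHt].
- by rewrite mulr0 !(tlift0 (B2 _)).
- by rewrite -pureZl !(tlift_pure (B2 _)) pureZ (pureZr d b c).
- by rewrite mulrDr !(tliftD (B2 _)) IHs IHt.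
Qed.

Lemma tassoc_pure a b c : tassoc ((a \ox b) \ox c) = a \ox (b \ox c).
Proof.
by rewrite /tassoc (tlift_pure tassoc_balanced1) (tlift_pure (tassoc_balanced2 c)).
Qed.

Fact tassoc_zmod : zmod_morphism tassoc.
Proof. exact/tlift_zmod/tassoc_balanced1. Qed.

Fact tassoc_monoid : monoid_morphism tassoc.
Proof.
have B2 := tassoc_balanced2.
apply: (tlift_monoid tassoc_balanced1) => [|s c t c'].
  by rewrite -pure11 (tlift_pure (B2 _)).
elim/tensor_ind: s => [|a b|s s' IHs IHs'];
  rewrite ?mul0r ?(tlift0 (B2 _)) ?mul0r //; last first.
  by rewrite mulrDl !(tliftD (B2 _)) IHs IHs' mulrDl.
elim/tensor_ind: t => [|a' b'|t t' IHt IHt'];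
  rewrite ?mulr0 ?(tlift0 (B2 _)) ?mulr0 //; last first.
  by rewrite mulrDr !(tliftD (B2 _)) IHt IHt' mulrDr.
by rewrite pureM !(tlift_pure (B2 _)) !pureM.
Qed.

Fact tassoc_scal (c : k) : tassoc c%:S = c%:S.
Proof. by rewrite !tscalE tassoc_pure. Qed.

HB.instance Definition _ := GRing.isZmodMorphism.Build _ _ tassoc tassoc_zmod.
HB.instance Definition _ :=
  GRing.isMonoidMorphism.Build _ _ tassoc tassoc_monoid.
HB.instance Definition _ :=
  isScalMorphism.Build k _ _ tassoc tassoc_scal.

End Tassoc.

(* The algebra k<G | R> presented by generators G and relations R: terms      *)
(* modulo the smallest congruence containing R and the k-algebra axioms.      *)
Section Presentation.
Variables (k : fieldType) (G : Type).

Inductive pterm :=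
| PGen of G
| PCst of k
| PAdd of pterm & pterm
| PMul of pterm & pterm.

Variable R : pterm -> pterm -> Prop.

Inductive pcong : pterm -> pterm -> Prop :=
| pc_rel s t : R s t -> pcong s t
| pc_refl s : pcong s s
| pc_sym s t : pcong s t -> pcong t s
| pc_trans s t u : pcong s t -> pcong t u -> pcong s u
| pc_add s s' t t' : pcong s s' -> pcong t t' -> pcong (PAdd s t) (PAdd s' t')
| pc_mul s s' t t' : pcong s s' -> pcong t t' -> pcong (PMul s t) (PMul s' t')
| pc_addA s t u : pcong (PAdd s (PAdd t u)) (PAdd (PAdd s t) u)
| pc_addC s t : pcong (PAdd s t) (PAdd t s)
| pc_add0 t : pcong (PAdd (PCst 0) t) t
| pc_addN t : pcong (PAdd (PMul (PCst (-1)) t) t) (PCst 0)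
| pc_mulA s t u : pcong (PMul s (PMul t u)) (PMul (PMul s t) u)
| pc_mul1l t : pcong (PMul (PCst 1) t) t
| pc_mul1r t : pcong (PMul t (PCst 1)) t
| pc_mulDl s t u : pcong (PMul (PAdd s t) u) (PAdd (PMul s u) (PMul t u))
| pc_mulDr s t u : pcong (PMul s (PAdd t u)) (PAdd (PMul s t) (PMul s u))
| pc_cstD c d : pcong (PCst (c + d)) (PAdd (PCst c) (PCst d))
| pc_cstM c d : pcong (PCst (c * d)) (PMul (PCst c) (PCst d))
| pc_cstC c t : pcong (PMul (PCst c) t) (PMul t (PCst c)).

Let prel (s t : pterm) : bool := `[< pcong s t >].

HB.instance Definition _ := gen_eqMixin pterm.
HB.instance Definition _ := gen_choiceMixin pterm.

Fact prel_refl : reflexive prel.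
Proof. by move=> s; apply/asboolP/pc_refl. Qed.
Fact prel_sym : symmetric prel.
Proof. by move=> s t; apply/asboolP/asboolP; exact: pc_sym. Qed.
Fact prel_trans : transitive prel.
Proof. by move=> t s u /asboolP st /asboolP tu; apply/asboolP/(pc_trans st). Qed.

Definition pequiv := EquivRel prel prel_refl prel_sym prel_trans.

Definition palg : Type := {eq_quot pequiv}.
HB.instance Definition _ := Choice.on palg.
HB.instance Definition _ := EqQuotient.on palg.

Definition pcl (s : pterm) : palg := \pi_palg s.

Lemma pclP s t : pcl s = pcl t <-> pcong s t.
Proof. by split=> [/eqmodP/asboolP //|h]; apply/eqmodP/asboolP. Qed.

Lemma pclW (P : palg -> Prop) : (forall s, P (pcl s)) -> forall t, P t.
Proof. by move=> Ps t; rewrite -[t]reprK; exact: Ps. Qed.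

Lemma pcl_repr t : pcl (repr t) = t. Proof. exact: reprK. Qed.

Lemma repr_pcl s : pcong (repr (pcl s)) s.
Proof. by apply/pclP; rewrite pcl_repr. Qed.

Definition padd (s t : palg) := pcl (PAdd (repr s) (repr t)).
Definition pmul (s t : palg) := pcl (PMul (repr s) (repr t)).
Definition popp (s : palg) := pmul (pcl (PCst (-1))) s.

Lemma paddE s t : padd (pcl s) (pcl t) = pcl (PAdd s t).
Proof. by apply/pclP/pc_add; exact: repr_pcl. Qed.
Lemma pmulE s t : pmul (pcl s) (pcl t) = pcl (PMul s t).
Proof. by apply/pclP/pc_mul; exact: repr_pcl. Qed.

Let pE := (paddE, pmulE).

Fact paddA : associative padd.
Proof.
elim/pclW=> s; elim/pclW=> t; elim/pclW=> u.
by rewrite !pE; exact/pclP/pc_addA.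
Qed.
Fact paddC : commutative padd.
Proof. by elim/pclW=> s; elim/pclW=> t; rewrite !pE; exact/pclP/pc_addC. Qed.
Fact padd0 : left_id (pcl (PCst 0)) padd.
Proof. by elim/pclW=> s; rewrite !pE; exact/pclP/pc_add0. Qed.
Fact paddN : left_inverse (pcl (PCst 0)) popp padd.
Proof. by elim/pclW=> s; rewrite /popp !pE; exact/pclP/pc_addN. Qed.
Fact pmulA : associative pmul.
Proof.
elim/pclW=> s; elim/pclW=> t; elim/pclW=> u.
by rewrite !pE; exact/pclP/pc_mulA.
Qed.
Fact pmul1l : left_id (pcl (PCst 1)) pmul.
Proof. by elim/pclW=> s; rewrite !pE; exact/pclP/pc_mul1l. Qed.
Fact pmul1r : right_id (pcl (PCst 1)) pmul.
Proof. by elim/pclW=> s; rewrite !pE; exact/pclP/pc_mul1r. Qed.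
Fact pmulDl : left_distributive pmul padd.
Proof.
elim/pclW=> s; elim/pclW=> t; elim/pclW=> u.
by rewrite !pE; exact/pclP/pc_mulDl.
Qed.
Fact pmulDr : right_distributive pmul padd.
Proof.
elim/pclW=> s; elim/pclW=> t; elim/pclW=> u.
by rewrite !pE; exact/pclP/pc_mulDr.
Qed.

HB.instance Definition _ := GRing.isZmodule.Build palg paddA paddC padd0 paddN.
HB.instance Definition _ :=
  GRing.Zmodule_isPzRing.Build palg pmulA pmul1l pmul1r pmulDl pmulDr.

Definition pcst (c : k) : palg := pcl (PCst c).

Lemma pclD s t : pcl (PAdd s t) = pcl s + pcl t.
Proof. by rewrite -paddE. Qed.
Lemma pclM s t : pcl (PMul s t) = pcl s * pcl t.
Proof. by rewrite -pmulE. Qed.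

Fact pcst_zmod : zmod_morphism pcst.
Proof.
move=> c d; apply: (addIr (pcst d)); rewrite subrK /pcst -pclD.
by apply/pclP; rewrite -[c in X in pcong _ X](subrK d); apply/pc_sym/pc_cstD.
Qed.
Fact pcst_monoid : monoid_morphism pcst.
Proof. by split=> // c d; rewrite /pcst -pclM; apply/pclP/pc_cstM. Qed.
Fact pcstC (c : k) (t : palg) : pcst c * t = t * pcst c.
Proof. by elim/pclW: t => t; rewrite /pcst -!pclM; apply/pclP/pc_cstC. Qed.

HB.instance Definition _ :=
  PzRing_isPzAlgebra.Build k palg pcst_zmod pcst_monoid pcstC.

Lemma pcl_cst c : pcl (PCst c) = c%:S. Proof. by []. Qed.

Definition pgen (g : G) : palg := pcl (PGen g).

Lemma palg_ind (P : palg -> Prop) :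
  (forall g, P (pgen g)) -> (forall c : k, P c%:S) ->
  (forall s t, P s -> P t -> P (s + t)) ->
  (forall s t, P s -> P t -> P (s * t)) -> forall t, P t.
Proof.
move=> Pg Pc PD PM; elim/pclW.
elim=> [g|c|s IHs t IHt|s IHs t IHt]; rewrite ?pclD ?pclM; [exact: Pg|..].
- exact: Pc.
- exact: PD.
- exact: PM.
Qed.

Section Lift.
Variables (B : pzAlgType k) (f : G -> B).

Fixpoint peval (s : pterm) : B :=
  match s with
  | PGen g => f g
  | PCst c => c%:S
  | PAdd s t => peval s + peval t
  | PMul s t => peval s * peval t
  end.

Definition respects := forall s t, R s t -> peval s = peval t.
Hypothesis fR : respects.

Lemma peval_cong s t : pcong s t -> peval s = peval t.
Proof.
elim=> {s t} //=.
- by move=> s t u _ -> _ ->.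
- by move=> s s' t t' _ -> _ ->.
- by move=> s s' t t' _ -> _ ->.
- by move=> *; rewrite addrA.
- by move=> *; rewrite addrC.
- by move=> *; rewrite rmorph0 add0r.
- by move=> *; rewrite rmorphN1 mulN1r addNr rmorph0.
- by move=> *; rewrite mulrA.
- by move=> *; rewrite rmorph1 mul1r.
- by move=> *; rewrite rmorph1 mulr1.
- by move=> *; rewrite mulrDl.
- by move=> *; rewrite mulrDr.
- by move=> *; rewrite rmorphD.
- by move=> *; rewrite rmorphM.
- by move=> *; rewrite scalC.
Qed.

Definition plift (t : palg) : B := let _ := fR in peval (repr t).

Lemma plift_pcl s : plift (pcl s) = peval s.
Proof. exact/peval_cong/repr_pcl. Qed.

Lemma plift_pgen g : plift (pgen g) = f g.
Proof. exact: plift_pcl. Qed.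

Lemma pliftD : {morph plift : s t / s + t}.
Proof. by elim/pclW=> s; elim/pclW=> t; rewrite -pclD !plift_pcl. Qed.

Fact plift_zmod : zmod_morphism plift.
Proof. by move=> s t; apply: (addIr (plift t)); rewrite -pliftD !subrK. Qed.
Fact plift_monoid : monoid_morphism plift.
Proof.
split; first by rewrite -[1]/(pcl (PCst 1)) plift_pcl /= rmorph1.
by elim/pclW=> s; elim/pclW=> t; rewrite -pclM !plift_pcl.
Qed.
Fact plift_scal (c : k) : plift c%:S = c%:S.
Proof. by rewrite -pcl_cst plift_pcl. Qed.

HB.instance Definition _ := GRing.isZmodMorphism.Build _ _ plift plift_zmod.
HB.instance Definition _ :=
  GRing.isMonoidMorphism.Build _ _ plift plift_monoid.
HB.instance Definition _ := isScalMorphism.Build k _ _ plift plift_scal.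
End Lift.

Lemma palg_ext (B : pzAlgType k) (f g : palg -> B) :
  is_algmap f -> is_algmap g ->
  (forall x, f (pgen x) = g (pgen x)) -> f =1 g.
Proof.
move=> fA gA fg; elim/palg_ind=> [//|c|s t IHs IHt|s t IHs IHt].
- by rewrite (is_algmap_scal fA) (is_algmap_scal gA).
- by rewrite (is_algmapD fA) (is_algmapD gA) IHs IHt.
- by rewrite (is_algmapM fA) (is_algmapM gA) IHs IHt.
Qed.

End Presentation.

Arguments PGen {k G}.
Arguments PCst {k G}.
Arguments PAdd {k G}.
Arguments PMul {k G}.
Arguments pgen {k G} R g.

Declare Scope pterm_scope.
Delimit Scope pterm_scope with PT.
Bind Scope pterm_scope with pterm.
Notation "s + t" := (PAdd s t) : pterm_scope.
Notation "s * t" := (PMul s t) : pterm_scope.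

Record hopfAlgebra (k : fieldType) := HopfAlgebra {
  hopf_alg :> pzAlgType k;
  coprod : {algmap hopf_alg -> tensor hopf_alg hopf_alg};
  counit : {algmap hopf_alg -> k^o};
  antipode : hopf_alg -> hopf_alg;
  coprodA : forall h : hopf_alg,
    tassoc (tmap coprod idfun (coprod h)) = tmap idfun coprod (coprod h);
  counitl : forall h : hopf_alg,
    tlift (fun a b : hopf_alg => (counit a : k)%:S * b) (coprod h) = h;
  counitr : forall h : hopf_alg,
    tlift (fun a b : hopf_alg => a * (counit b : k)%:S) (coprod h) = h;
  antipode_klin : k_linear antipode;
  antipodel : forall h : hopf_alg,
    tlift (fun a b : hopf_alg => antipode a * b) (coprod h) = (counit h : k)%:S;
  antipoder : forall h : hopf_alg,
    tlift (fun a b : hopf_alg => a * antipode b) (coprod h) = (counit h : k)%:S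
}.
Arguments coprod {k} _.
Arguments counit {k} _.
Arguments antipode {k} _ _.

Record comodAlgebra (k : fieldType) (H : hopfAlgebra k) := ComodAlgebra {
  comod_alg :> pzAlgType k;
  coact : {algmap comod_alg -> tensor comod_alg H};
  coactA : forall a : comod_alg,
    tassoc (tmap coact idfun (coact a)) = tmap idfun (coprod H) (coact a);
  coact_counit : forall a : comod_alg,
    tlift (fun (b : comod_alg) (h : H) => b * (counit H h : k)%:S) (coact a) = a
}.
Arguments coact {k H} _.

Definition colinear (k : fieldType) (H : hopfAlgebra k)
    (A B : comodAlgebra H) (f : A -> B) : Prop :=
  forall a : A, coact B (f a) = tmap f idfun (coact A a).

(* The tensor algebra of the direct sum of the X_i^H is presented by the      *)
(* symbols X_i^h subject to linearity in h. Indices start at 0: the generator *)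
(* (i, h) stands for X_(i+1)^h.                                               *)
Section TensorAlgebra.
Variables (k : fieldType) (H : hopfAlgebra k).

Inductive T_rel : pterm k (nat * H) -> pterm k (nat * H) -> Prop :=
| T_lin i (c : k) (h h' : H) :
    T_rel (PGen (i, c%:S * h + h')) (PCst c * PGen (i, h) + PGen (i, h'))%PT.

Definition tensorAlg : Type := palg T_rel.
HB.instance Definition _ := PzAlgebra.on tensorAlg.

Definition TX (i : nat) (h : H) : tensorAlg := pgen T_rel (i, h).

Lemma TX_klin i : k_linear (TX i).
Proof.
move=> c h h'; rewrite /TX -pcl_cst -pclM -pclD.
by apply/pclP/pc_rel; constructor.
Qed.

(* X_i^h |-> X_i^(h_1) (x) h_2 *)
Definition T_coact_gen (g : nat * H) : tensor tensorAlg H :=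
  tmap (TX g.1) idfun (coprod H g.2).

Fact T_coact_respects : respects T_rel T_coact_gen.
Proof.
move=> _ _ [i c h h'] /=; rewrite /T_coact_gen /=.
rewrite algmap_klin tmap_klin //; exact: TX_klin.
Qed.

Definition T_coact : {algmap tensorAlg -> tensor tensorAlg H} :=
  plift T_coact_respects.

Lemma T_coactX i h : T_coact (TX i h) = tmap (TX i) idfun (coprod H h).
Proof. exact: (plift_pgen T_coact_respects). Qed.

Fact T_coactA a :
  tassoc (tmap T_coact idfun (T_coact a)) = tmap idfun (coprod H) (T_coact a).
Proof.
pose F : {algmap tensorAlg -> tensor tensorAlg (tensor H H)} :=
  @tassoc k tensorAlg H H \o (tmap T_coact idfun \o T_coact).
pose G : {algmap tensorAlg -> tensor tensorAlg (tensor H H)} :=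
  tmap idfun (coprod H) \o T_coact.
rewrite -[LHS]/(F a) -[RHS]/(G a).
apply: (palg_ext (algmapP F) (algmapP G)) => -[i h] /=.
rewrite -/(TX i h) T_coactX.
have XL := TX_klin i; have IL : k_linear (@idfun H) by exact: id_klin.
have DL := algmap_klin (coprod H); have TL := algmap_klin T_coact.
have JL : k_linear (@idfun (tensor H H)) by exact: id_klin.
have -> : tmap T_coact idfun (tmap (TX i) idfun (coprod H h)) =
          tmap (tmap (TX i) idfun) idfun (tmap (coprod H) idfun (coprod H h)).
  elim/tensor_ind: (coprod H h) => [|b h'|s t IHs IHt].
  - by rewrite !tmap0 //; exact: tmap_klin.
  - by rewrite !tmap_pure //= ?T_coactX //; exact: tmap_klin.
  - by rewrite !tmapD ?IHs ?IHt //; exact: tmap_klin.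
have -> t : tassoc (tmap (tmap (TX i) idfun) idfun t) =
            tmap (TX i) idfun (tassoc t) :> tensor tensorAlg (tensor H H).
  have KL : k_linear (tmap (TX i) (@idfun H)) by exact: tmap_klin.
  elim/tensor_ind: t => [|s c|s t IHs IHt].
  - by rewrite tmap0 // !raddf0 tmap0.
  - rewrite tmap_pure //=.
    elim/tensor_ind: s => [|a' b|s t IHs IHt].
    + by rewrite tmap0 // !pure0l !raddf0 tmap0.
    + by rewrite tmap_pure // !tassoc_pure tmap_pure.
    + by rewrite tmapD // !pureDl !raddfD tmapD //= IHs IHt.
  - by rewrite tmapD // !raddfD tmapD //= IHs IHt.
rewrite coprodA.
have TI : k_linear (@idfun tensorAlg) by exact: id_klin.
elim/tensor_ind: (coprod H h) => [|b h'|s t IHs IHt].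
- by rewrite !tmap0.
- by rewrite !tmap_pure.
- by rewrite !tmapD ?IHs ?IHt.
Qed.

Fact T_coact_counit a :
  tlift (fun b h => b * (counit H h : k)%:S) (T_coact a) = a.
Proof.
pose e := tlift (fun (b : tensorAlg) h => b * (counit H h : k)%:S).
have eA : is_algmap e.
  apply: mul_is_algmap; [exact: (algmapP idfun) | exact: scal_is_algmap |].
  by move=> b h; rewrite scalC.
have eTA := comp_is_algmap eA (algmapP T_coact).
apply: (palg_ext eTA (algmapP idfun)) => -[i h] /=.
rewrite -/(TX i h) T_coactX -[in RHS](counitr h).
have XL := TX_klin i; have IL : k_linear (@idfun H) by exact: id_klin.
have eL := is_algmap_klin (scal_is_algmap H (counit H)).
have eTL := is_algmap_klin (scal_is_algmap tensorAlg (counit H)).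
have eB := mul_balanced (id_klin (A := H)) eL.
have eTB := mul_balanced (id_klin (A := tensorAlg)) eTL.
elim/tensor_ind: (coprod H h) => [|b h'|s t IHs IHt].
- by rewrite tmap0 // /e (tlift0 eTB) (tlift0 eB) (klin0 XL).
- by rewrite tmap_pure // /e (tlift_pure eTB) (tlift_pure eB) /= -!scalC (klinZ XL).
- by rewrite tmapD // (is_algmapD eA) IHs IHt (tliftD eB) (klinD XL).
Qed.

Definition T_comod : comodAlgebra H := ComodAlgebra T_coactA T_coact_counit.

End TensorAlgebra.

Definition polynomial_identity (k : fieldType) (H : hopfAlgebra k)
    (A : comodAlgebra H) (P : T_comod H) : Prop :=
  forall mu : {algmap T_comod H -> A}, colinear mu -> mu P = 0.

Section En.
Variables (k : fieldType) (n : nat).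

Inductive En_gen : Type := En_genx | En_geny of 'I_n.

Local Notation tx := (PGen En_genx).
Local Notation ty i := (PGen (En_geny i)).

Inductive En_rel : pterm k En_gen -> pterm k En_gen -> Prop :=
| En_relxx : En_rel (tx * tx)%PT (PCst 1)
| En_relyy i : En_rel (ty i * ty i)%PT (PCst 0)
| En_relyx i : En_rel (ty i * tx + tx * ty i)%PT (PCst 0)
| En_relyyC i j : En_rel (ty i * ty j + ty j * ty i)%PT (PCst 0).

Definition EnAlg : Type := palg En_rel.
HB.instance Definition _ := PzAlgebra.on EnAlg.

Definition Ex : EnAlg := pgen En_rel En_genx.
Definition Ey (i : 'I_n) : EnAlg := pgen En_rel (En_geny i).

Lemma Exx : Ex * Ex = 1.
Proof. by rewrite -pclM; apply/pclP/pc_rel; constructor. Qed.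
Lemma Eyy i : Ey i * Ey i = 0.
Proof. by rewrite -pclM; apply/pclP/pc_rel; constructor. Qed.
Lemma Eyx i : Ey i * Ex = - (Ex * Ey i).
Proof.
apply/eqP; rewrite -addr_eq0; apply/eqP.
by rewrite -!pclM -pclD; apply/pclP/pc_rel; constructor.
Qed.
Lemma EyyC i j : Ey i * Ey j = - (Ey j * Ey i).
Proof.
apply/eqP; rewrite -addr_eq0; apply/eqP.
by rewrite -!pclM -pclD; apply/pclP/pc_rel; constructor.
Qed.

Section SkewPrimitive.
Variables (A : pzAlgType k) (p q : A) (i j : 'I_n).
Let dp := (1 : A) \ox Ey i + p \ox Ex.
Let dq := (1 : A) \ox Ey j + q \ox Ex.

Lemma skew_anticomm : dp * dq + dq * dp = (p * q + q * p) \ox 1.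
Proof.
rewrite /dp /dq !mulrDl !mulrDr !pureM !mulr1 !mul1r !Exx !Eyx (EyyC i j).
rewrite !pureNr pureDl.
rewrite (AC ((2*2)*(2*2)) ((1*5)*(2*7)*(3*6)*(4*8)))%AC /=.
by rewrite !addNr subrr !add0r.
Qed.

Lemma skew_sqr : dp * dp = (p * p) \ox 1.
Proof.
rewrite /dp !mulrDl !mulrDr !pureM !mulr1 !mul1r Exx Eyx Eyy.
by rewrite pure0r pureNr add0r addrA addNr add0r.
Qed.

Lemma skew_group_anticomm :
  dp * (q \ox Ex) + (q \ox Ex) * dp = (p * q + q * p) \ox 1.
Proof.
rewrite /dp !mulrDl !mulrDr !pureM !mulr1 !mul1r Exx Eyx.
by rewrite pureNr addrACA addNr add0r pureDl.
Qed.

End SkewPrimitive.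

Definition En_coprod_gen (g : En_gen) : tensor EnAlg EnAlg :=
  match g with
  | En_genx => Ex \ox Ex
  | En_geny i => 1 \ox Ey i + Ey i \ox Ex
  end.

Fact En_coprod_respects : respects En_rel En_coprod_gen.
Proof.
move=> _ _ [|i|i|i j] /=; rewrite ?rmorph0 ?rmorph1.
- by rewrite pureM !Exx.
- by rewrite skew_sqr Eyy pure0l.
- by rewrite skew_group_anticomm Eyx addNr pure0l.
- by rewrite skew_anticomm EyyC addNr pure0l.
Qed.

Definition En_coprod : {algmap EnAlg -> tensor EnAlg EnAlg} :=
  plift En_coprod_respects.

Lemma En_coprodx : En_coprod Ex = Ex \ox Ex.
Proof. exact: plift_pgen. Qed.
Lemma En_coprody i : En_coprod (Ey i) = 1 \ox Ey i + Ey i \ox Ex.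
Proof. exact: plift_pgen. Qed.

Definition En_counit_gen (g : En_gen) : k^o :=
  match g with En_genx => 1 | En_geny _ => 0 end.

Fact En_counit_respects : respects En_rel En_counit_gen.
Proof.
by move=> _ _ [|i|i|i j] /=; rewrite ?rmorph0 ?rmorph1 ?mulr0 ?mul0r ?mulr1 ?addr0.
Qed.

Definition En_counit : {algmap EnAlg -> k^o} := plift En_counit_respects.

Lemma En_counitx : En_counit Ex = 1.
Proof. exact: plift_pgen. Qed.
Lemma En_counity i : En_counit (Ey i) = 0.
Proof. exact: plift_pgen. Qed.

(* The antipode is an antimorphism, i.e. a morphism to the opposite algebra.  *)
Definition En_antipode_gen (g : En_gen) : GRing.converse EnAlg :=
  match g with En_genx => Ex | En_geny i => - (Ey i * Ex) end.

Fact En_antipode_respects : respects En_rel En_antipode_gen.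
Proof.
have yxyx i j : - (Ey i * Ex) * - (Ey j * Ex) = - (Ey i * Ey j).
  by rewrite mulrNN [Ey j * Ex]Eyx mulrN mulrA -(mulrA (Ey i)) Exx mulr1.
move=> _ _ [|i|i|i j] /=; rewrite ?rmorph0 ?rmorph1.
- exact: Exx.
- by rewrite -[LHS]/(- (Ey i * Ex) * - (Ey i * Ex)) yxyx Eyy oppr0.
- rewrite -[LHS]/(Ex * - (Ey i * Ex) + - (Ey i * Ex) * Ex).
  by rewrite {1}Eyx opprK mulNr mulrA -(mulrA (Ey i)) Exx mul1r mulr1 subrr.
- rewrite -[LHS]/(- (Ey j * Ex) * - (Ey i * Ex) + - (Ey i * Ex) * - (Ey j * Ex)).
  by rewrite !yxyx (EyyC i j) opprK addNr.
Qed.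

Definition En_antipode : EnAlg -> EnAlg := plift En_antipode_respects.

Lemma En_antipodex : En_antipode Ex = Ex.
Proof. exact: (plift_pgen En_antipode_respects). Qed.
Lemma En_antipodey i : En_antipode (Ey i) = - (Ey i * Ex).
Proof. exact: (plift_pgen En_antipode_respects). Qed.
Lemma En_antipode_scal (c : k) : En_antipode c%:S = c%:S.
Proof. exact: (plift_scal En_antipode_respects). Qed.
Lemma En_antipodeD : {morph En_antipode : s t / s + t}.
Proof. exact: (pliftD En_antipode_respects). Qed.
Lemma En_antipodeM s t : En_antipode (s * t) = En_antipode t * En_antipode s.
Proof. exact: (plift_monoid En_antipode_respects).2. Qed.

Fact En_antipode_klin : k_linear En_antipode.
Proof.
move=> c s t.
by rewrite En_antipodeD En_antipodeM En_antipode_scal -scalC.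
Qed.

Fact En_coprodA h :
  tassoc (tmap En_coprod idfun (En_coprod h)) =
  tmap idfun En_coprod (En_coprod h).
Proof.
pose F : {algmap EnAlg -> tensor EnAlg (tensor EnAlg EnAlg)} :=
  @tassoc k EnAlg EnAlg EnAlg \o (tmap En_coprod idfun \o En_coprod).
pose G : {algmap EnAlg -> tensor EnAlg (tensor EnAlg EnAlg)} :=
  tmap idfun En_coprod \o En_coprod.
rewrite -[LHS]/(F h) -[RHS]/(G h).
apply: (palg_ext (algmapP F) (algmapP G)).
have DL := algmap_klin En_coprod; have IL := id_klin (A := EnAlg).
case=> [|i] /=.
  by rewrite -/Ex En_coprodx !tmap_pure //= En_coprodx tassoc_pure.
rewrite -/(Ey i) En_coprody !tmapD // !tmap_pure //= !En_coprody En_coprodx.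
rewrite rmorph1 -(pure11 EnAlg EnAlg) pureDl !pureDr !raddfD /= !tassoc_pure.
by rewrite addrA.
Qed.

Fact En_counitl h :
  tlift (fun a b : EnAlg => (En_counit a : k)%:S * b) (En_coprod h) = h.
Proof.
have eA := scal_is_algmap EnAlg En_counit.
have iA := algmapP (@idfun EnAlg).
have eB := mul_balanced (is_algmap_klin eA) (is_algmap_klin iA).
have FA := mul_is_algmap eA iA (fun a b => scalC _ _).
apply: (palg_ext (comp_is_algmap FA (algmapP En_coprod)) iA) => -[|i] /=.
  by rewrite -/Ex En_coprodx (tlift_pure eB) /= En_counitx
             (rmorph1 (@scal k EnAlg)) mul1r.
rewrite -/(Ey i) En_coprody (tliftD eB) !(tlift_pure eB) /= En_counity.
by rewrite rmorph1 (rmorph1 (@scal k EnAlg)) (rmorph0 (@scal k EnAlg)) mul1r mul0r addr0.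
Qed.

Fact En_counitr h :
  tlift (fun a b : EnAlg => a * (En_counit b : k)%:S) (En_coprod h) = h.
Proof.
have eA := scal_is_algmap EnAlg En_counit.
have iA := algmapP (@idfun EnAlg).
have eB := mul_balanced (is_algmap_klin iA) (is_algmap_klin eA).
have FA := mul_is_algmap iA eA (fun a b => esym (scalC _ _)).
apply: (palg_ext (comp_is_algmap FA (algmapP En_coprod)) iA) => -[|i] /=.
  by rewrite -/Ex En_coprodx (tlift_pure eB) /= En_counitx
             (rmorph1 (@scal k EnAlg)) mulr1.
rewrite -/(Ey i) En_coprody (tliftD eB) !(tlift_pure eB) /= En_counity En_counitx.
by rewrite (rmorph1 (@scal k EnAlg)) (rmorph0 (@scal k EnAlg)) mulr1 mulr0 add0r.
Qed.

Fact En_antipodel h :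
  tlift (fun a b : EnAlg => En_antipode a * b) (En_coprod h) =
  (En_counit h : k)%:S.
Proof.
have SB : balanced (fun a b : EnAlg => En_antipode a * b) :=
  mul_balanced En_antipode_klin (id_klin (A := EnAlg)).
have eA := scal_is_algmap EnAlg En_counit.
elim/palg_ind: h => [[|i]|c|s t IHs IHt|s t IHs IHt].
- by rewrite -/Ex En_coprodx (tlift_pure SB) /= En_antipodex Exx En_counitx
             (rmorph1 (@scal k EnAlg)).
- rewrite -/(Ey i) En_coprody (tliftD SB) !(tlift_pure SB) /= En_antipodey.
  rewrite -{1}(rmorph1 (@scal k EnAlg)) En_antipode_scal.
  rewrite (rmorph1 (@scal k EnAlg)) En_counity (rmorph0 (@scal k EnAlg)).
  by rewrite mul1r mulNr -mulrA Exx mulr1 subrr.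
- by rewrite !rmorph_scal tscalE (tlift_pure SB) /= En_antipode_scal mulr1.
- by rewrite !raddfD /= (tliftD SB) IHs IHt -(is_algmapD eA) raddfD.
- have -> : En_coprod (s * t) = En_coprod s * En_coprod t by exact: rmorphM.
  rewrite [RHS](is_algmapM eA) -IHt -IHs.
  elim/tensor_ind: (En_coprod t) => [|a b|u v IHu IHv].
  + by rewrite mulr0 (tlift0 SB) mulr0.
  + rewrite (tlift_pure SB) IHs !mulrA scalC -mulrA -IHs.
    elim/tensor_ind: (En_coprod s) => [|a' b'|u v IHu IHv].
    * by rewrite mul0r (tlift0 SB) mul0r mulr0.
    * by rewrite pureM !(tlift_pure SB) /= En_antipodeM !mulrA.
    * by rewrite mulrDl !(tliftD SB) IHu IHv mulrDl mulrDr.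
  + by rewrite mulrDr !(tliftD SB) IHu IHv mulrDr.
Qed.

Fact En_antipoder h :
  tlift (fun a b : EnAlg => a * En_antipode b) (En_coprod h) =
  (En_counit h : k)%:S.
Proof.
have SB : balanced (fun a b : EnAlg => a * En_antipode b) :=
  mul_balanced (id_klin (A := EnAlg)) En_antipode_klin.
have eA := scal_is_algmap EnAlg En_counit.
elim/palg_ind: h => [[|i]|c|s t IHs IHt|s t IHs IHt].
- by rewrite -/Ex En_coprodx (tlift_pure SB) /= En_antipodex Exx En_counitx
             (rmorph1 (@scal k EnAlg)).
- rewrite -/(Ey i) En_coprody (tliftD SB) !(tlift_pure SB) /= En_antipodey.
  rewrite En_antipodex En_counity (rmorph0 (@scal k EnAlg)).
  by rewrite mul1r addNr.
- rewrite !rmorph_scal tscalE (tlift_pure SB) /=.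
  by rewrite -(rmorph1 (@scal k EnAlg)) En_antipode_scal (rmorph1 (@scal k EnAlg)) mulr1.
- by rewrite !raddfD /= (tliftD SB) IHs IHt -(is_algmapD eA) raddfD.
- have -> : En_coprod (s * t) = En_coprod s * En_coprod t by exact: rmorphM.
  rewrite [RHS](is_algmapM eA) -IHt -IHs.
  elim/tensor_ind: (En_coprod s) => [|a b|u v IHu IHv].
  + by rewrite mul0r (tlift0 SB) mul0r.
  + rewrite (tlift_pure SB) IHt -!mulrA -scalC mulrA -IHt.
    elim/tensor_ind: (En_coprod t) => [|a' b'|u v IHu IHv].
    * by rewrite mulr0 !(tlift0 SB) mulr0 mul0r.
    * by rewrite pureM !(tlift_pure SB) /= En_antipodeM !mulrA.
    * by rewrite mulrDr !(tliftD SB) IHu IHv mulrDr mulrDl.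
  + by rewrite mulrDl !(tliftD SB) IHu IHv mulrDl.
Qed.

Definition En : hopfAlgebra k :=
  HopfAlgebra En_coprodA En_counitl En_counitr
    En_antipode_klin En_antipodel En_antipoder.

End En.

Arguments Ex {k n}.
Arguments Ey {k n} i.

Section Acd.
Variables (k : fieldType) (n : nat) (a : k) (c : 'rV[k]_n) (d : 'M[k]_n).

Inductive Acd_gen : Type := Acd_genu | Acd_genui of 'I_n.

Local Notation tu := (PGen Acd_genu).
Local Notation tui i := (PGen (Acd_genui i)).

Inductive Acd_rel : pterm k Acd_gen -> pterm k Acd_gen -> Prop :=
| Acd_reluu : Acd_rel (tu * tu)%PT (PCst a)
| Acd_relii i : Acd_rel (tui i * tui i)%PT (PCst (c 0 i))
| Acd_relui i : Acd_rel (tu * tui i + tui i * tu)%PT (PCst 0)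
| Acd_relij i j : Acd_rel (tui i * tui j + tui j * tui i)%PT (PCst (d i j)).

Definition AcdAlg : Type := palg Acd_rel.
HB.instance Definition _ := PzAlgebra.on AcdAlg.

Definition Au : AcdAlg := pgen Acd_rel Acd_genu.
Definition Aui (i : 'I_n) : AcdAlg := pgen Acd_rel (Acd_genui i).

Lemma Auu : Au * Au = a%:S.
Proof. by rewrite -pclM; apply/pclP/pc_rel; constructor. Qed.
Lemma Auii i : Aui i * Aui i = (c 0 i)%:S.
Proof. by rewrite -pclM; apply/pclP/pc_rel; constructor. Qed.
Lemma Auui i : Au * Aui i + Aui i * Au = 0.
Proof.
rewrite -[RHS](rmorph0 (@scal k AcdAlg)) -!pclM -pclD.
by apply/pclP/pc_rel; constructor.
Qed.
Lemma Auij i j : Aui i * Aui j + Aui j * Aui i = (d i j)%:S.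
Proof. by rewrite -!pclM -pclD; apply/pclP/pc_rel; constructor. Qed.

Definition Acd_coact_gen (g : Acd_gen) : tensor AcdAlg (En k n) :=
  match g with
  | Acd_genu => Au \ox (Ex : En k n)
  | Acd_genui i => 1 \ox (Ey i : En k n) + Aui i \ox (Ex : En k n)
  end.

Fact Acd_coact_respects : respects Acd_rel Acd_coact_gen.
Proof.
move=> _ _ [|i|i|i j] /=.
- by rewrite pureM Auu Exx.
- by rewrite skew_sqr Auii.
- by rewrite addrC skew_group_anticomm addrC Auui pure0l rmorph0.
- by rewrite skew_anticomm Auij.
Qed.

Definition Acd_coact : {algmap AcdAlg -> tensor AcdAlg (En k n)} :=
  plift Acd_coact_respects.

Lemma Acd_coactu : Acd_coact Au = Au \ox (Ex : En k n).
Proof. exact: (plift_pgen Acd_coact_respects). Qed.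
Lemma Acd_coactui i :
  Acd_coact (Aui i) = 1 \ox (Ey i : En k n) + Aui i \ox (Ex : En k n).
Proof. exact: (plift_pgen Acd_coact_respects). Qed.

Fact Acd_coactA x :
  tassoc (tmap Acd_coact idfun (Acd_coact x)) =
  tmap idfun (coprod (En k n)) (Acd_coact x).
Proof.
pose H := En k n.
pose F : {algmap AcdAlg -> tensor AcdAlg (tensor H H)} :=
  @tassoc k AcdAlg H H \o (tmap Acd_coact idfun \o Acd_coact).
pose G : {algmap AcdAlg -> tensor AcdAlg (tensor H H)} :=
  tmap idfun (coprod H) \o Acd_coact.
rewrite -[LHS]/(F x) -[RHS]/(G x).
apply: (palg_ext (algmapP F) (algmapP G)).
have DL := algmap_klin (coprod H); have IL := id_klin (A := H).
have CL := algmap_klin Acd_coact; have JL := id_klin (A := AcdAlg).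
have Dx : coprod H Ex = (Ex : H) \ox (Ex : H) := @En_coprodx k n.
have Dy i : coprod H (Ey i) = 1 \ox (Ey i : H) + (Ey i : H) \ox (Ex : H)
  := @En_coprody k n i.
case=> [|i].
  rewrite -[LHS]/(tassoc (tmap Acd_coact idfun (Acd_coact Au))).
  rewrite -[RHS]/(tmap idfun (coprod H) (Acd_coact Au)).
  by rewrite Acd_coactu !tmap_pure // Acd_coactu Dx tassoc_pure.
rewrite -[LHS]/(tassoc (tmap Acd_coact idfun (Acd_coact (Aui i)))).
rewrite -[RHS]/(tmap idfun (coprod H) (Acd_coact (Aui i))).
rewrite Acd_coactui !tmapD // !tmap_pure // Acd_coactui Dx Dy.
rewrite rmorph1 -(pure11 AcdAlg H) pureDl !pureDr !raddfD /= !tassoc_pure.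
by rewrite addrA.
Qed.

Fact Acd_coact_counit x :
  tlift (fun (b : AcdAlg) (h : En k n) => b * (counit (En k n) h : k)%:S)
    (Acd_coact x) = x.
Proof.
have eA := scal_is_algmap AcdAlg (counit (En k n)).
have iA := algmapP (@idfun AcdAlg).
have eB := mul_balanced (is_algmap_klin iA) (is_algmap_klin eA).
have FA := mul_is_algmap iA eA (fun a b => esym (scalC _ _)).
have ex : counit (En k n) Ex = 1 := @En_counitx k n.
have ey i : counit (En k n) (Ey i) = 0 := @En_counity k n i.
apply: (palg_ext (comp_is_algmap FA (algmapP Acd_coact)) iA).
case=> [|i]; rewrite [LHS]/comp.
  by rewrite Acd_coactu (tlift_pure eB) ex (rmorph1 (@scal k AcdAlg)) mulr1.
rewrite Acd_coactui (tliftD eB) !(tlift_pure eB) ex ey.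
by rewrite (rmorph1 (@scal k AcdAlg)) (rmorph0 (@scal k AcdAlg)) mulr1 mulr0 add0r.
Qed.

Definition Acd : comodAlgebra (En k n) :=
  ComodAlgebra Acd_coactA Acd_coact_counit.

End Acd.

(* Main.v *)
Require Import Defs.
From HB Require Import structures.
From mathcomp Require Import all_boot all_algebra.
From mathcomp Require Import boolp classical_sets cardinality.
From mathcomp Require Import ring.

Set Implicit Arguments.
Unset Strict Implicit.
Unset Printing Implicit Defensive.

Import GRing.Theory.
Local Open Scope ring_scope.

(** Let mu : T -> A = A(a, c, d) be a comodule algebra map. Colinearity says
    that mu E is coinvariant, that the coaction sends mu X to mu X (x) x, and
    that it sends mu Y_i to mu E (x) y_i + mu Y_i (x) x. Everything rests on
    the fact that the coinvariants of A are the scalars ([Acd_coinvariant]).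
    It gives mu E = e; as mu X * u is coinvariant and u^2 = a is invertible,
    mu X = l u ([Acd_grouplike]); as mu Y_i - e u_i satisfies the same equation
    as mu X, mu Y_i = e u_i + m_i u ([Acd_skew_primitive]). In the
    Clifford-like algebra A the squares and the anticommutators of such
    elements are scalars ([clifford_sqr], [clifford_anticomm]):
      XY_i + Y_iX = 2 l m_i a,     X^2 = l^2 a,    Y_i^2 = e^2 c_i + m_i^2 a,
      Y_iY_j + Y_jY_i = e^2 d_ij + 2 m_i m_j a,
    and both identities become identities between polynomials in e, l, m_i, m_j
    over k.

    The coinvariants are found without exhibiting a basis of A, so that the
    argument also covers the case A = 0. The coaction is composed with the
    representations x |-> diag(1, -1), y_i |-> v_i e_12 of E(n), where v is a
    vector of scalars. The result is an algebra map from A to the 2 x 2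
    matrices over A ([probe]) that sends a coinvariant t to diag(t, t), and u_i
    to the matrix with rows (u_i, v_i) and (0, - u_i): its upper right entry is
    a skew derivation of A which takes the value v_i at u_i and vanishes at u.
    By means of the relations, an element of the subalgebra generated by u and
    the u_j with j <= i can be written p + q u_i, with p and q free of u_i
    ([initial_subalg_split]). For v the i-th unit vector, the skew
    derivation maps it to q, so that q = 0 if the element is coinvariant. Thus all the u_i can be removed
    from a coinvariant ([coinvariant_descent]), which is then of the form
    z + z' u; the lower right entry with v = 0 is an automorphism sending u to
    - u, whence z' u = 0 in characteristic different from 2. *)

(** * Matrices over an algebra *)

Lemma scalMM (k : fieldType) (A : pzAlgType k) (x y : k) (s t : A) :
  (x%:S * s) * (y%:S * t) = (x * y)%:S * (s * t).
Proof. by rewrite rmorphM /= -!mulrA; congr (_ * _); rewrite !mulrA scalC. Qed.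

Section MatrixAlg.
Variables (k : fieldType) (A : pzAlgType k) (m : nat).

Fact mx_scal_zmod : zmod_morphism (fun c : k => (c%:S : A)%:M : 'M[A]_m).
Proof. by move=> x y; rewrite !raddfB. Qed.
Fact mx_scal_monoid : monoid_morphism (fun c : k => (c%:S : A)%:M : 'M[A]_m).
Proof.
split=> [|x y]; first by rewrite rmorph1.
by rewrite rmorphM scalar_mxM.
Qed.
Fact mx_scalC (c : k) (M : 'M[A]_m) : (c%:S : A)%:M * M = M * (c%:S : A)%:M.
Proof.
apply/matrixP=> i j; rewrite -!mulmxE !mxE.
rewrite (bigD1 i) //= [RHS](bigD1 j) //= !mxE !eqxx !mulr1n scalC.
congr (_ + _); rewrite !big1 // => l lj; rewrite !mxE.
  by rewrite (negbTE lj) mulr0.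
by rewrite eq_sym (negbTE lj) mul0r.
Qed.
HB.instance Definition _ :=
  PzRing_isPzAlgebra.Build k 'M[A]_m mx_scal_zmod mx_scal_monoid mx_scalC.

Lemma scalar_mx_algmap : is_algmap (fun t : A => t%:M : 'M[A]_m).
Proof.
split=> [x y||//]; first by rewrite raddfB.
by split=> // x y; rewrite scalar_mxM.
Qed.

End MatrixAlg.

Section Matrix2.
Variables (k : fieldType) (A : pzAlgType k).

Definition mx2 (x y z w : A) : 'M[A]_2 :=
  \matrix_(i, j) if i == 0 then (if j == 0 then x else y)
                 else (if j == 0 then z else w).

Lemma mx2M x y z w x' y' z' w' : mx2 x y z w * mx2 x' y' z' w' =
  mx2 (x * x' + y * z') (x * y' + y * w') (z * x' + w * z') (z * y' + w * w').
Proof.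
by apply/matrixP=> i j; rewrite -mulmxE !mxE !big_ord_recl big_ord0 addr0 !mxE;
  case: (i == 0); case: (j == 0).
Qed.

Lemma mx2D x y z w x' y' z' w' : mx2 x y z w + mx2 x' y' z' w' =
  mx2 (x + x') (y + y') (z + z') (w + w').
Proof. by apply/matrixP=> i j; rewrite !mxE; case: (i == 0); case: (j == 0). Qed.

Lemma mx2_scalar x : x%:M = mx2 x 0 0 x.
Proof.
by apply/matrixP=> -[[|[|[]]] //= ?] [[|[|[]]] //= ?]; rewrite !mxE.
Qed.

Lemma mx2_inj x y z w x' y' z' w' :
  mx2 x y z w = mx2 x' y' z' w' -> [/\ x = x', y = y', z = z' & w = w'].
Proof.
move=> /matrixP e.
by have:= (e 0 0, e 0 1, e 1 0, e 1 1); rewrite !mxE /= => -[[[-> ->] ->] ->].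
Qed.

End Matrix2.

(** * Probing comodule algebras with representations of E(n) *)

Section Probe.
Variables (k : fieldType) (n : nat) (A : comodAlgebra (En k n)).
Variable v : 'I_n -> k.

Definition En_rep_gen (g : En_gen n) : 'M[A]_2 :=
  match g with
  | En_genx => mx2 1 0 0 (-1)
  | En_geny i => mx2 0 (v i)%:S 0 0
  end.

Fact En_rep_respects : respects (@En_rel k n) En_rep_gen.
Proof.
have mx0 : (0 : k)%:S = mx2 0 0 0 0 :> 'M[A]_2.
  by rewrite rmorph0 -mx2_scalar raddf0.
move=> _ _ [|i|i|i j] /=; rewrite ?mx0 ?rmorph1 !mx2M ?mx2D;
  rewrite ?(mulr0, mul0r, mul1r, mulr1, addr0, add0r, mulN1r, mulrN1, opprK) //.
- by rewrite -mx2_scalar.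
- by rewrite addNr.
Qed.

Definition En_rep : {algmap En k n -> 'M[A]_2} := plift En_rep_respects.

(** The entries of [En_rep h] are scalars, hence central in A. *)
Lemma scalar_mx_En_repC (t : A) (h : En k n) : t%:M * En_rep h = En_rep h * t%:M.
Proof.
elim/palg_ind: h => [g|z|x y IHx IHy|x y IHx IHy].
- rewrite [En_rep _](plift_pgen En_rep_respects) mx2_scalar.
  case: g => [|i] /=; rewrite !mx2M ?(mulr0, mul0r, addr0, add0r, mulr1, mul1r) //.
    by rewrite mulrN1 mulN1r.
  by rewrite scalC.
- by rewrite rmorph_scal scalC.
- by rewrite rmorphD mulrDl mulrDr IHx IHy.
- by rewrite rmorphM mulrA IHx -[LHS]mulrA IHy mulrA.
Qed.

Lemma En_repx : En_rep Ex = mx2 1 0 0 (-1).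
Proof. exact: (plift_pgen En_rep_respects). Qed.
Lemma En_repy i : En_rep (Ey i) = mx2 0 (v i)%:S 0 0.
Proof. exact: (plift_pgen En_rep_respects). Qed.

Definition probe (t : A) : 'M[A]_2 :=
  tlift (fun (s : A) h => s%:M * En_rep h) (coact A t).

Lemma probe_balanced : balanced (fun (s : A) h => s%:M * En_rep h).
Proof.
exact: mul_balanced (is_algmap_klin (scalar_mx_algmap A 2))
                    (algmap_klin En_rep).
Qed.

Lemma probe_is_algmap : is_algmap probe.
Proof.
apply: comp_is_algmap (algmapP (coact A)).
exact: mul_is_algmap (scalar_mx_algmap A 2) (algmapP En_rep) scalar_mx_En_repC.
Qed.

Lemma probe_coinvariant t : coact A t = t \ox 1 -> probe t = mx2 t 0 0 t.
Proof.
by move=> ct; rewrite /probe ct (tlift_pure probe_balanced) rmorph1 mulr1 mx2_scalar.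
Qed.

Lemma probe_grouplike t :
  coact A t = t \ox (Ex : En k n) -> probe t = mx2 t 0 0 (- t).
Proof.
move=> ct; rewrite /probe ct (tlift_pure probe_balanced) En_repx.
by rewrite mx2_scalar mx2M !(mulr0, mul0r, mulr1, addr0, add0r, mulrN1).
Qed.

Lemma probe_skew_primitive i t :
  coact A t = 1 \ox (Ey i : En k n) + t \ox (Ex : En k n) ->
  probe t = mx2 t (v i)%:S 0 (- t).
Proof.
move=> ct; rewrite /probe ct (tliftD probe_balanced).
rewrite !(tlift_pure probe_balanced) En_repx En_repy !mx2_scalar !mx2M mx2D.
by rewrite !(mulr0, mul0r, mul1r, mulr1, addr0, add0r, mulrN1).
Qed.

End Probe.

(** * Coinvariants of A(a, c, d) *)

Section Coinvariants.
Variables (k : fieldType) (n : nat) (a : k) (c : 'rV[k]_n) (d : 'M[k]_n).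
Let A := Acd a c d.
Local Notation u := (Au a c d : A).
Local Notation ui i := (Aui a c d i : A).

(** A filtration of A along which the u_i are eliminated one at a time. *)
Inductive initial_subalg (m : nat) : A -> Prop :=
| initial_scal z : initial_subalg m z%:S
| initial_u : initial_subalg m u
| initial_ui (i : 'I_n) : (i < m)%N -> initial_subalg m (ui i)
| initial_add s t :
    initial_subalg m s -> initial_subalg m t -> initial_subalg m (s + t)
| initial_mul s t :
    initial_subalg m s -> initial_subalg m t -> initial_subalg m (s * t).

Lemma initial_subalg0 m : initial_subalg m 0.
Proof. by rewrite -(rmorph0 (@scal k A)); constructor. Qed.

Lemma initial_subalg1 m : initial_subalg m 1.
Proof. by rewrite -(rmorph1 (@scal k A)); constructor. Qed.

Lemma initial_subalg_opp m s : initial_subalg m s -> initial_subalg m (- s).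
Proof.
by move=> ms; rewrite -mulN1r -(rmorphN1 (@scal k A)); do 2?constructor.
Qed.

Lemma initial_subalg_full t : initial_subalg n t.
Proof.
elim/palg_ind: t => [[|i]|z|x y IHx IHy|x y IHx IHy].
- exact: initial_u.
- exact: initial_ui.
- exact: initial_scal.
- exact: initial_add.
- exact: initial_mul.
Qed.

(** By the relations u_i can be moved to the right of any generator, at the
    cost of a sign and of a scalar. *)
Lemma initial_subalg_swap (i : 'I_n) s : initial_subalg i s ->
  exists p q,
    [/\ initial_subalg i p, initial_subalg i q & ui i * s = p + q * ui i].
Proof.
elim=> {s} [z||j ji|s t _ [p [q [mp mq e]]] _ [p' [q' [mp' mq' e']]]|
            s t _ [p [q [mp mq e]]] mt [p' [q' [mp' mq' e']]]].
- exists 0, z%:S; split; [exact: initial_subalg0|constructor|].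
  by rewrite add0r scalC.
- exists 0, (- u); split; first exact: initial_subalg0.
    exact/initial_subalg_opp/initial_u.
  by rewrite add0r mulNr; apply/eqP; rewrite -addr_eq0 addrC; apply/eqP/Auui.
- exists (d i j)%:S, (- ui j); split; first by constructor.
    exact/initial_subalg_opp/initial_ui.
  by apply/eqP; rewrite mulNr -subr_eq opprK; apply/eqP/Auij.
- exists (p + p'), (q + q'); split; try by constructor.
  by rewrite mulrDr e e' mulrDl addrACA.
- exists (p * t + q * p'), (q * q'); split; try by repeat constructor.
  by rewrite mulrA e mulrDl -!mulrA e' mulrDr !mulrA addrA.
Qed.

(** The elements p + q u_i form a subalgebra: in a product, the inner u_i is
    moved to the right, where u_i^2 = c_i. *)
Lemma initial_subalg_split (i : 'I_n) t : initial_subalg i.+1 t ->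
  exists p q, [/\ initial_subalg i p, initial_subalg i q & t = p + q * ui i].
Proof.
have [i0 i1] := (initial_subalg0 i, initial_subalg1 i).
elim=> {t} [z||j|s t _ [p [q [mp mq ->]]] _ [p' [q' [mp' mq' ->]]]|
            s t _ [p [q [mp mq ->]]] _ [p' [q' [mp' mq' ->]]]].
- by exists z%:S, 0; split=> //; [constructor|rewrite mul0r addr0].
- by exists u, 0; split=> //; [constructor|rewrite mul0r addr0].
- rewrite ltnS leq_eqVlt => /orP[/eqP/val_inj ->|ji].
    by exists 0, 1; rewrite mul1r add0r.
  by exists (ui j), 0; split=> //; [constructor|rewrite mul0r addr0].
- exists (p + p'), (q + q'); split; try by constructor.
  by rewrite mulrDl addrACA.
- have [r [r' [mr mr' er]]] := initial_subalg_swap mp'.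
  have [s' [s'' [ms ms' es]]] := initial_subalg_swap mq'.
  exists (p * p' + q * r + q * s'' * (c 0 i)%:S), (p * q' + q * r' + q * s').
  split; try by repeat constructor.
  rewrite mulrDl !mulrDr -(mulrA q (ui i) p') er.
  rewrite (mulrA (q * ui i)) -(mulrA q (ui i) q') es.
  rewrite -[(c 0 i)%:S](Auii a c d i) !mulrDr !mulrDl !mulrA.
  by rewrite (AC (2*(2*2)) ((1*3*6)*(2*4*5)))%AC.
Qed.

(** A skew derivation that vanishes on the generators of a subalgebra vanishes
    on all of it. *)
Lemma probe_initial_subalg (i : 'I_n) v t :
  (forall j : 'I_n, (j < i)%N -> v j = 0) ->
  initial_subalg i t -> exists w, probe v t = mx2 t 0 0 w.
Proof.
have PA := probe_is_algmap A v.
move=> v0; elim=> {t} [z||j ji|s t _ [w e] _ [w' e']|s t _ [w e] _ [w' e']].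
- by exists z%:S; rewrite (is_algmap_scal PA) -mx2_scalar.
- by exists (- u); rewrite probe_grouplike //; exact: Acd_coactu.
- exists (- ui j); rewrite (@probe_skew_primitive _ _ _ _ j) ?v0 ?rmorph0 //.
  exact: Acd_coactui.
- by exists (w + w'); rewrite (is_algmapD PA) e e' mx2D !addr0.
- by exists (w * w');
    rewrite (is_algmapM PA) e e' mx2M !(mulr0, mul0r, addr0, add0r).
Qed.

(** Write t = p + q u_i. The skew derivation that is 1 at u_i and 0 at the
    other generators maps t to q, and it kills coinvariants. *)
Lemma coinvariant_descent (i : 'I_n) t :
  coact A t = t \ox 1 -> initial_subalg i.+1 t -> initial_subalg i t.
Proof.
move=> ct /initial_subalg_split[p [q [mp mq tE]]].
pose v (j : 'I_n) : k := (j == i)%:R; have PA := probe_is_algmap A v.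
have v0 (j : 'I_n) : (j < i)%N -> v j = 0.
  by move=> ji; rewrite /v (_ : j == i = false) // -val_eqE ltn_eqF.
have [w pE] := probe_initial_subalg v0 mp.
have [w' qE] := probe_initial_subalg v0 mq.
have := probe_coinvariant v ct.
rewrite {1}tE (is_algmapD PA) (is_algmapM PA) pE qE.
rewrite (@probe_skew_primitive _ _ _ _ i (ui i)); last exact: Acd_coactui.
rewrite mx2M mx2D => /mx2_inj[_ + _ _].
rewrite /v eqxx rmorph1 mulr1 mul0r addr0 add0r => q0.
by rewrite tE q0 mul0r addr0.
Qed.

Lemma initial_subalg0P t :
  initial_subalg 0 t -> exists x y : k, t = x%:S + y%:S * u.
Proof.
elim=> {t} [z||//|s t _ [x [y ->]] _ [x' [y' ->]]|s t _ [x [y ->]] _ [x' [y' ->]]].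
- by exists z, 0; rewrite rmorph0 mul0r addr0.
- by exists 0, 1; rewrite rmorph0 rmorph1 mul1r add0r.
- by exists (x + x'), (y + y'); rewrite !rmorphD mulrDl addrACA.
- exists (x * x' + y * y' * a), (x * y' + y * x').
  rewrite mulrDl !mulrDr scalMM Auu -(mulrA _ u) -(scalC x' u).
  rewrite !rmorphD !rmorphM /= mulrDl !mulrA.
  by rewrite (AC (2*2) ((1*4)*(2*3)))%AC.
Qed.

Hypothesis k2 : (2 : k) != 0.

Lemma Acd_coinvariant t : coact A t = t \ox 1 -> exists z : k, t = z%:S.
Proof.
move=> ct; have t0 : initial_subalg 0 t.
  have : forall m, (m <= n)%N -> initial_subalg (n - m) t.
    elim=> [|m IHm] mn; first by rewrite subn0; apply: initial_subalg_full.
    have mi : (n - m.+1 < n)%N by rewrite ltn_subrL (leq_trans _ mn).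
    apply: (@coinvariant_descent (Ordinal mi)) => //=.
    by rewrite subnSK //; apply/IHm/ltnW.
  by move=> /(_ n (leqnn n)); rewrite subnn.
have [x [y tE]] := initial_subalg0P t0; exists x.
(* For v = 0 the lower right entry is the automorphism u |-> - u. *)
have PA := probe_is_algmap A (fun=> 0).
have := probe_coinvariant (fun=> 0) ct.
rewrite {1}tE (is_algmapD PA) (is_algmapM PA) !(is_algmap_scal PA).
rewrite (@probe_grouplike _ _ _ _ u); last exact: Acd_coactu.
rewrite [x%:S]mx2_scalar [y%:S]mx2_scalar mx2M mx2D => /mx2_inj[_ _ _].
rewrite tE mul0r add0r mulrN => /addrI yu.
suff -> : y%:S * u = 0 by rewrite addr0.
rewrite -[LHS]mul1r -(rmorph1 (@scal k A)) -(mulVf k2) rmorphM /= -mulrA.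
by rewrite rmorph_nat mulr2n mulrDl mul1r -{1}yu addNr mulr0.
Qed.

Hypothesis a0 : a != 0.

(** Multiplication by the unit u turns t into a coinvariant, since x^2 = 1. *)
Lemma Acd_grouplike t :
  coact A t = t \ox (Ex : En k n) -> exists z : k, t = z%:S * u.
Proof.
move=> ct; have [|z tuE] := @Acd_coinvariant (t * u).
  rewrite (is_algmapM (algmapP (coact A))) ct.
  by rewrite [coact A u](Acd_coactu a c d) pureM Exx.
exists (z / a); rewrite rmorphM /= -tuE -[RHS]mulrA (scalC a^-1 u) mulrA.
by rewrite -(mulrA t) Auu -mulrA -rmorphM divff // rmorph1 mulr1.
Qed.

(** The equation is affine in t, and e u_i is a particular solution. *)
Lemma Acd_skew_primitive i (e : k) t :
  coact A t = e%:S \ox (Ey i : En k n) + t \ox (Ex : En k n) ->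
  exists z : k, t = e%:S * ui i + z%:S * u.
Proof.
move=> ct; have cA := algmapP (coact A).
have [|z tE] := @Acd_grouplike (t + (- e)%:S * ui i).
  rewrite (is_algmapD cA) ct (is_algmapM cA) (is_algmap_scal cA).
  rewrite [coact A (ui i)](Acd_coactui a c d) mulrDr -!pureZl mulr1 addrACA.
  by rewrite -!pureDl -rmorphD subrr rmorph0 pure0l add0r.
exists z; rewrite -tE addrCA -mulrDl -rmorphD subrr rmorph0.
by rewrite mul0r addr0.
Qed.

End Coinvariants.

(** * Colinear maps out of the tensor algebra *)

Lemma colinear_coactX (k : fieldType) (H : hopfAlgebra k) (A : comodAlgebra H)
    (mu : {algmap T_comod H -> A}) (i : nat) (h : H) : colinear mu ->
  coact A (mu (TX i h)) = tmap (fun g => mu (TX i g)) idfun (coprod H h).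
Proof.
move=> mu_colin.
have XL := TX_klin (H := H) i; have muL := algmap_klin mu.
have IL := id_klin (A := H); have muXL := comp_klin muL XL.
rewrite mu_colin [coact _ _]T_coactX.
elim/tensor_ind: (coprod _ h) => [|b h'|s t IHs IHt].
- by rewrite !tmap0.
- by rewrite !tmap_pure.
- by rewrite !tmapD ?IHs ?IHt.
Qed.

Lemma Acd_colinear_images (k : fieldType) (n : nat) (a : k) (c : 'rV[k]_n)
    (d : 'M[k]_n) (mu : {algmap T_comod (En k n) -> Acd a c d}) (r : nat) :
  (2 : k) != 0 -> a != 0 -> colinear mu ->
  exists (e l : k) (m : 'I_n -> k),
    [/\ mu (TX r 1) = e%:S, mu (TX r (Ex : En k n)) = l%:S * Au a c d
      & forall i, mu (TX r (Ey i : En k n)) =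
                 e%:S * Aui a c d i + (m i)%:S * Au a c d].
Proof.
move=> k2 a0 mu_colin; have coactX h := colinear_coactX r h mu_colin.
have IL := id_klin (A := En k n).
have muXL := comp_klin (algmap_klin mu) (TX_klin (H := En k n) r).
have [|e eE] := @Acd_coinvariant k n a c d k2 (mu (TX r 1)).
  by rewrite coactX rmorph1 -pure11 tmap_pure.
have [|l lE] := @Acd_grouplike k n a c d k2 a0 (mu (TX r (Ex : En k n))).
  by rewrite coactX [coprod _ _]En_coprodx tmap_pure.
have mP i : exists z : k,
    mu (TX r (Ey i : En k n)) = e%:S * Aui a c d i + z%:S * Au a c d.
  apply: Acd_skew_primitive => //.
  by rewrite coactX [coprod _ _]En_coprody tmapD // !tmap_pure // -eE.
by have [m mE] := choice mP; exists e, l, m.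
Qed.

(** * Clifford relations and the identities *)

Section Clifford.
Variables (k : fieldType) (A : pzAlgType k) (a : k) (u : A).
Hypothesis uu : u * u = a%:S.

Lemma clifford_anticomm (x y x' y' b : k) (v w : A) :
  u * v + v * u = 0 -> u * w + w * u = 0 -> v * w + w * v = b%:S ->
  (x%:S * v + y%:S * u) * (x'%:S * w + y'%:S * u)
  + (x'%:S * w + y'%:S * u) * (x%:S * v + y%:S * u)
  = (x * x' * b + 2 * y * y' * a)%:S.
Proof.
(* The right-hand side is named so that refactoring leaves its 2 alone. *)
move=> uv uw vw; set z := RHS; rewrite !mulrDl !mulrDr !scalMM uu.
rewrite (mulrC x') (mulrC y' y) (mulrC x' y) (mulrC y' x).
rewrite (AC ((2*2)*(2*2)) ((1*5)*(2*7)*(3*6)*(4*8)))%AC /= -!mulrDr vw.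
rewrite uw (addrC (v * u)) uv !mulr0 !addr0 -!rmorphD -!rmorphM -rmorphD.
by apply: (congr1 (@scal k A)); ring.
Qed.

Lemma clifford_sqr (x y b : k) (v : A) : u * v + v * u = 0 -> v * v = b%:S ->
  (x%:S * v + y%:S * u) * (x%:S * v + y%:S * u) = (x ^+ 2 * b + y ^+ 2 * a)%:S.
Proof.
move=> uv vv; rewrite !mulrDl !mulrDr !scalMM uu vv (mulrC y x).
rewrite (AC (2*2) ((1*4)*(2*3)))%AC /= -mulrDr addrC (addrC (v * u)) uv.
by rewrite mulr0 add0r -!rmorphM -rmorphD /= -!expr2.
Qed.

End Clifford.

Theorem proposition4p1 (k : fieldType) (k_infinite : infinite_set [set: k])
  (k_char : 2%N \notin [pchar k]) (n : nat) (n_ge1 : (1 <= n)%N)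
  (a : k) (a_neq0 : a != 0) (c : 'rV[k]_n)
  (d : 'M[k]_n) (d_sym : forall i j, d i j = d j i) :
  let E : T_comod (En k n) := TX 0 (1 : En k n) in
  let X : T_comod (En k n) := TX 0 (Ex : En k n) in
  let Y (i : 'I_n) : T_comod (En k n) := TX 0 (Ey i : En k n) in
  (forall i : 'I_n,
    polynomial_identity (Acd a c d)
      ((X * Y i + Y i * X) ^+ 2 - 4 * X ^+ 2 * Y i ^+ 2
       + (4 * c 0 i)%:S * E ^+ 2 * X ^+ 2)) /\
  (forall i j : 'I_n, (i <= j)%N ->
    polynomial_identity (Acd a c d)
      (2 * (Y i * Y j + Y j * Y i) * X ^+ 2
       - (X * Y i + Y i * X) * (X * Y j + Y j * X)
       - (2 * d i j)%:S * E ^+ 2 * X ^+ 2)).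
Proof.
move=> E X Y; have k2 : (2 : k) != 0 by move: k_char; rewrite inE.
have uu := Auu a c d; have uv := Auui a c d; have vw := Auij a c d.
split=> [i|i j _] mu /(Acd_colinear_images 0 k2 a_neq0)
    [e [l [m [muE muX muY]]]];
  have [muB [_ muM] muS] := algmapP mu; have muD := is_algmapD (algmapP mu);
  (have XX : mu X * mu X = (l ^+ 2 * a)%:S
     by rewrite muX scalMM uu -rmorphM -expr2);
  (have XY p : mu X * mu (Y p) + mu (Y p) * mu X = (2 * l * m p * a)%:S
     by have := clifford_anticomm uu 0 l e (m p) (uv p) (uv p) (vw p p);
        rewrite rmorph0 !mul0r !add0r -muX -muY).
- have YY := clifford_sqr uu e (m i) (uv i) (Auii a c d i).
  rewrite -muY in YY.
  rewrite !expr2 -[4](rmorph_nat (@scal k _)) muD muB !(muM, muD, muS).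
  rewrite XX YY XY muE -!rmorphM -rmorphB -rmorphD.
  by rewrite -[RHS](rmorph0 (@scal k _)); apply: (congr1 (@scal k _)); ring.
- have YY := clifford_anticomm uu e (m i) e (m j) (uv i) (uv j) (vw i j).
  rewrite -!muY in YY.
  rewrite !expr2 -[2](rmorph_nat (@scal k _)) !muB !(muM, muD, muS).
  rewrite XX YY !XY muE -!rmorphM -!rmorphB.
  by rewrite -[RHS](rmorph0 (@scal k _)); apply: (congr1 (@scal k _)); ring.
Qed.
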